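(* Let $\mathcal{S}$ be an instance of the hereditary $3$-set packing problem, let $A\subseteq\mathcal{S}$ be a feasible solution such that there is no local improvement of $A$ of size at most $10$, and let $B\subseteq\mathcal{S}$ be an optimum solution. Then $w(B)\le\frac{4}{3}\cdot w(A)$.
   Context: An instance of the hereditary $3$-set packing problem is a finite family $\mathcal{S}$ of nonempty sets, each of cardinality at most $3$, that is hereditary: for every $s\in\mathcal{S}$, every nonempty subset of $s$ belongs to $\mathcal{S}$. Each $s\in\mathcal{S}$ has weight $w(s)=|s|-1$, and for a subfamily $X$, $w(X)=\sum_{s\in X}w(s)$. A feasible solution is a subfamily of pairwise disjoint sets; an optimum solution is a feasible solution of maximum weight. For set families $U,W$, the neighborhood is $N(U,W)=\{x\in W:\exists u\in U: u\cap x\ne\emptyset\}$. Given a feasible solution $A$, a subfamily $X\subseteq\mathcal{S}$ of pairwise disjoint sets is a local improvement of $A$ of size $|X|$ if either $w(X)>w(N(X,A))$, or $w(X)=w(N(X,A))$ and $X$ contains more sets of weight $2$ than $N(X,A)$ does. *)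

(* Defs.v *)
From mathcomp Require Import all_boot.

Set Implicit Arguments.
Unset Strict Implicit.
Unset Printing Implicit Defensive.

Section HereditarySetPacking.
Variable T : finType.
Implicit Types (s t : {set T}) (S A B X U W : {set {set T}}).

(* The union of a finite family of finite sets is finite, so a finite ground
   type T covers every instance. *)
Definition hereditary_3set_instance S : Prop :=
  [/\ forall s, s \in S -> s != set0,
      forall s, s \in S -> #|s| <= 3
    & forall s t, s \in S -> t != set0 -> t \subset s -> t \in S].

(* The truncated predecessor is |s| - 1 on nonempty sets, in particular on all
   members of an instance. *)
Definition set_weight s : nat := #|s|.-1.

Definition weight X : nat := \sum_(s in X) set_weight s.

Definition feasible S A : Prop := A \subset S /\ trivIset A.

Definition optimum S B : Prop :=
  feasible S B /\ forall X, feasible S X -> weight X <= weight B.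

Definition neighborhood U W : {set {set T}} :=
  [set x in W | [exists u in U, u :&: x != set0]].

Definition num_weight2 X : nat := #|[set s in X | set_weight s == 2]|.

Definition local_improvement S A X : Prop :=
  [/\ X \subset S, trivIset X
    & weight X > weight (neighborhood X A)
      \/ (weight X = weight (neighborhood X A)
          /\ num_weight2 X > num_weight2 (neighborhood X A))].

End HereditarySetPacking.

(* Main.v *)
(* Swapping in the traces b :&: E (b in B) of a set E of points, and throwing out
   every set of A that meets E, is never an improvement if E meets at most 10
   sets of B. With the potential phi (10 times the weight, plus 1 for each
   triple) this says value B E <= cost A E. The value is supermodular in E and
   the cost submodular, so cheap point sets can be glued together without
   tracking how they overlap.

   Call a point of B free if A covers it by no set of weight > 0. A critical
   point w, i.e. a non-free point whose B-set has a free point u, costs nothing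
   but its own A-set: {w, u} has value 10. Each B-set sends at least 3 times its
   weight to the A-sets that it meets: in general 2 along each point, but 3
   along a critical point, 1 along a point x whose companion in a pair of A is
   critical (deficit x = 0), and then 3 along a point of a triple of A having at
   most one critical companion, to compensate. By gluing, an A-pair receives at
   most 4 and an A-triple at most 8, four times their weights. *)

Require Import Defs.
From mathcomp Require Import all_boot all_order all_algebra.
From mathcomp Require Import zify.

Set Implicit Arguments.
Unset Strict Implicit.
Unset Printing Implicit Defensive.

(* As at most 10 sets are swapped in, the factor 10 makes [phi] order swaps
   lexicographically by weight and then by number of triples; the truncated
   subtractions make it convex, with values 0, 0, 10, 21 at 0, 1, 2, 3. *)
Definition phi (n : nat) : nat := 10 * n.-1 + n.-2.

Lemma phi_mono m n : m <= n -> phi m <= phi n.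
Proof. by rewrite /phi; lia. Qed.

(** * Value and cost of a point set *)

Section Potential.
Variable T : finType.
Implicit Types (C D X : {set {set T}}) (E F a b : {set T}).

Definition value D E : nat := \sum_(b in D) phi #|b :&: E|.
Definition hit C E : {set {set T}} := [set a in C | a :&: E != set0].
Definition cost C E : nat := \sum_(a in hit C E) phi #|a|.

Lemma phi_sum_weight X : (forall s, s \in X -> #|s| <= 3) ->
  \sum_(s in X) phi #|s| = 10 * weight X + num_weight2 X.
Proof.
move=> X3; rewrite /weight /num_weight2 big_distrr -sum1_card /=.
rewrite [X in _ + X](_ : _ = \sum_(s in X) (set_weight s == 2)); last first.
  rewrite [RHS]big_mkcond [LHS]big_mkcond /=; apply: eq_bigr => s _.
  by rewrite inE; case: (s \in X); case: (set_weight s == 2).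
rewrite -big_split; apply: eq_bigr => s /X3; rewrite /phi /set_weight.
by case: #|s| => [|[|[|[|n]]]].
Qed.

Lemma costE C E :
  cost C E = \sum_(a in C) (if a :&: E != set0 then phi #|a| else 0).
Proof. by rewrite /cost -big_mkcondr; apply: eq_bigl => a; rewrite inE. Qed.

Lemma hitU C E F : hit C (E :|: F) = hit C E :|: hit C F.
Proof. by apply/setP => a; rewrite !inE setIUr setU_eq0 negb_and -andb_orr. Qed.

Lemma hit0 C : hit C set0 = set0.
Proof. by apply/setP => a; rewrite !inE setI0 eqxx andbF. Qed.

Lemma hitS C E F : E \subset F -> hit C E \subset hit C F.
Proof. by move=> /setUidPr <-; rewrite hitU subsetUl. Qed.

Lemma hit_bigcup C (Z : {set T}) (G : T -> {set T}) k :
  (forall z, z \in Z -> #|hit C (G z)| <= k) ->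
  #|hit C (\bigcup_(z in Z) G z)| <= #|Z| * k.
Proof.
move=> hk; apply: leq_trans (_ : \sum_(z in Z) #|hit C (G z)| <= _); last first.
  by rewrite -sum_nat_const; apply: leq_sum.
elim/big_rec2: _ => [|z n E _ le_n]; first by rewrite hit0 cards0.
by rewrite hitU; apply: leq_trans (leq_card_setU _ _) _; rewrite leq_add2l.
Qed.

Lemma value_mono D E F : E \subset F -> value D E <= value D F.
Proof.
move=> sEF; apply: leq_sum => b _.
exact/phi_mono/subset_leq_card/setIS.
Qed.

(** Convexity of [phi], set by set: the sizes of [b :&: E] and [b :&: F] lie between those of the
    traces of [E :&: F] and [E :|: F], with the same sum. *)
Lemma value_supermodular D E F :
  value D E + value D F <= value D (E :|: F) + value D (E :&: F).
Proof.
rewrite -!big_split; apply: leq_sum => b _ /=.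
have := cardsUI (b :&: E) (b :&: F).
rewrite -setIUr -setIIr.
have := subset_leq_card (setIS b (subsetUl E F)).
have := subset_leq_card (setIS b (subsetUr E F)).
by rewrite /phi; lia.
Qed.

(** A weighted coverage function: a set met by [E :&: F] is met by both [E] and [F]. *)
Lemma cost_submodular C E F :
  cost C (E :|: F) + cost C (E :&: F) <= cost C E + cost C F.
Proof.
rewrite !costE -!big_split; apply: leq_sum => a _ /=.
rewrite setIUr setU_eq0 setIIr.
have [->|_] := eqVneq (a :&: E) set0; first by rewrite set0I eqxx /= addn0.
have [->|_] := eqVneq (a :&: F) set0; first by rewrite setI0 eqxx /=.
by rewrite /=; case: ifP; lia.
Qed.

Lemma value0 D : value D set0 = 0.
Proof. by rewrite /value big1 // => b _; rewrite setI0 cards0. Qed.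

Lemma cost0 C : cost C set0 = 0.
Proof. by rewrite /cost hit0 big_set0. Qed.

Lemma cost_subadditive C E F : cost C (E :|: F) <= cost C E + cost C F.
Proof. exact: leq_trans (leq_addr _ _) (cost_submodular C E F). Qed.

Lemma cost_setD1_bounds C a E : a \in C ->
  cost (C :\ a) E <= cost C E <= phi #|a| + cost (C :\ a) E.
Proof.
move=> aC.
have -> : cost C E = (if a :&: E != set0 then phi #|a| else 0) + cost (C :\ a) E.
  rewrite !costE (bigD1 a) //=; congr (_ + _).
  by apply: eq_bigl => x; rewrite !inE andbC.
by rewrite leq_addl leq_add2r /=; case: ifP; rewrite ?leqnn.
Qed.

Lemma value_setD1 D b E : b \in D ->
  value D E = phi #|b :&: E| + value (D :\ b) E.
Proof.
move=> bD; rewrite /value (bigD1 b) //=; congr (_ + _).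
by apply: eq_bigl => x; rewrite !inE andbC.
Qed.

Lemma value_single D b E : trivIset D -> b \in D -> E \subset b ->
  value D E = phi #|E|.
Proof.
move=> tD bD sE; rewrite (value_setD1 _ bD) (setIidPr sE).
rewrite /value big1 ?addn0 // => c; rewrite !inE => /andP[cb cD].
have /trivIsetP/(_ _ _ cD bD cb)/disjoint_setI0 cb0 := tD.
have : c :&: E \subset set0 by rewrite -cb0 setIS.
by rewrite subset0 => /eqP->; rewrite cards0.
Qed.

Lemma card_hit_single D b E : trivIset D -> b \in D -> E \subset b ->
  #|hit D E| <= 1.
Proof.
move=> tD bD sE; rewrite -(cards1 b); apply: subset_leq_card.
apply/subsetP => c; rewrite !inE => /andP[cD]; apply: contraNT => cb.
have /trivIsetP/(_ _ _ cD bD cb)/disjoint_setI0 cb0 := tD.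
by rewrite -subset0 -cb0 setIS.
Qed.

End Potential.

(** * Local optimality and gluing *)

Section LocalOptimum.
Variables (T : finType) (S A B : {set {set T}}).
Hypotheses (instS : hereditary_3set_instance S)
  (feasA : feasible S A) (feasB : feasible S B).
Hypothesis optA :
  ~ (exists X : {set {set T}}, local_improvement S A X /\ #|X| <= 10).
Implicit Types (a b : {set T}) (E F : {set T}) (C D : {set {set T}}).

Let AS : A \subset S. Proof. by case: feasA. Qed.
Let BS : B \subset S. Proof. by case: feasB. Qed.
Let tA : trivIset A. Proof. by case: feasA. Qed.
Let tB : trivIset B. Proof. by case: feasB. Qed.

Lemma cardA a : a \in A -> #|a| <= 3.
Proof. by case: instS => _ + _ => /[swap] /(subsetP AS) ? /(_ a); apply. Qed.

Lemma cardB b : b \in B -> #|b| <= 3.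
Proof. by case: instS => _ + _ => /[swap] /(subsetP BS) ? /(_ b); apply. Qed.

Lemma value_le_cost E : #|hit B E| <= 10 -> value B E <= cost A E.
Proof.
move=> hitE; rewrite leqNgt; apply/negP => lt_cv.
pose X := [set b :&: E | b in hit B E].
have injX : {in hit B E &, injective (fun b => b :&: E)}.
  move=> b c; rewrite !inE => /andP[bB /set0Pn[x]] + /andP[cB _] eq_bc.
  have xbc := eq_bc; move/setP/(_ x): xbc => + xb; rewrite xb => /esym xc.
  move: xb xc; rewrite !inE => /andP[xb _] /andP[xc _].
  by rewrite -(def_pblock tB bB xb) (def_pblock tB cB xc).
have XS : X \subset S.
  apply/subsetP => _ /imsetP[b + ->]; rewrite inE => /andP[bB bE].
  by case: instS => _ _ /(_ b); apply; rewrite ?subsetIl ?(subsetP BS).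
have tX : trivIset X.
  apply/trivIsetP => _ _ /imsetP[b + ->] /imsetP[c + ->].
  rewrite !inE => /andP[bB _] /andP[cB _] neq.
  have {}neq : b != c by apply: contraNneq neq => ->.
  have /trivIsetP/(_ _ _ bB cB neq) := tB.
  by move=> /disjointW; apply; apply: subsetIl.
have cardX : #|X| <= 10 by apply: leq_trans hitE; apply: leq_imset_card.
have phiX : \sum_(s in X) phi #|s| = value B E.
  rewrite big_imset //= /value big_mkcond [RHS]big_mkcond /=.
  apply: eq_bigr => b _; rewrite inE; case: (b \in B) => //=.
  by case: eqP => //= ->; rewrite cards0.
have phiN : \sum_(s in neighborhood X A) phi #|s| <= cost A E.
  rewrite /cost big_mkcond [leqRHS]big_mkcond /=; apply: leq_sum => a _.
  case: ifP => //; rewrite !inE => /andP[-> /exists_inP[_ /imsetP[b _ ->]]].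
  move=> /set0Pn[x]; rewrite !inE => /andP[/andP[_ xE] xa] /=.
  by rewrite ifT //; apply/set0Pn; exists x; rewrite inE xa.
rewrite !phi_sum_weight in phiX phiN; first last.
- by move=> s; rewrite inE => /andP[/cardA].
- by move=> s /(subsetP XS); case: instS => _ + _; apply.
(* The at most 10 triples of [X] cannot make up for one lost unit of weight, which [phi] counts as
   10. *)
have n2X : num_weight2 X <= #|X|.
  by apply: subset_leq_card; apply/subsetP => s; rewrite inE => /andP[].
apply: optA; exists X; split=> //; split=> //.
by lia.
Qed.


Lemma merge D C E F e e' d d' : D \subset B -> C \subset A ->
  #|hit B E| <= 10 ->
  (forall a, a \in A -> a \notin C -> a :&: (E :&: F) = set0) ->
  cost C E + e <= value D E + d -> cost C F + e' <= value D F + d' ->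
  cost C (E :|: F) + (e + e') <= value D (E :|: F) + (d + d').
Proof.
move=> sDB sCA hitE EF0 leE leF.
have hitEF : #|hit B (E :&: F)| <= 10.
  by apply: leq_trans hitE; apply/subset_leq_card/hitS/subsetIl.
have costEF : cost A (E :&: F) <= cost C (E :&: F).
  rewrite /cost big_mkcond [leqRHS]big_mkcond /=; apply: leq_sum => a _.
  case: ifP => //; rewrite !inE => /andP[aA]; case aC: (a \in C) => //=.
    by move->.
  by rewrite EF0 ?aC // eqxx.
have valueEF : value D (E :&: F) <= value B (E :&: F).
  rewrite /value big_mkcond [leqRHS]big_mkcond /=; apply: leq_sum => b _.
  by case: ifP => // /(subsetP sDB) ->.
have := value_supermodular D E F; have := cost_submodular C E F.
by have := value_le_cost hitEF; lia.
Qed.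

Lemma merge_bigcup D C (Z : {set T}) (G : T -> {set T}) e d :
  D \subset B -> C \subset A ->
  (forall z, z \in Z -> #|hit B (G z)| <= 10) ->
  (forall a z z', a \in A -> a \notin C -> z \in Z -> z' \in Z -> z != z' ->
    a :&: (G z :&: G z') = set0) ->
  (forall z, z \in Z -> cost C (G z) + e z <= value D (G z) + d z) ->
  cost C (\bigcup_(z in Z) G z) + \sum_(z in Z) e z
    <= value D (\bigcup_(z in Z) G z) + \sum_(z in Z) d z.
Proof.
move=> sDB sCA hitG G0 leG; rewrite -!big_enum /=.
have : all (mem Z) (enum Z) by apply/allP => z; rewrite mem_enum.
have := enum_uniq Z; elim: (enum Z) => [|z s IH] /=.
  by rewrite !big_nil cost0.
move=> /andP[zs us] /andP[zZ sZ]; rewrite !big_cons.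
(* Only the new piece must meet at most 10 sets of [B]; the union built so far may meet more. *)
apply: merge => //; [exact: hitG| |exact: leG|exact: IH].
move=> a aA aC; apply/eqP; rewrite -subset0; apply/subsetP => t.
rewrite !inE => /and3P[ta tz].
rewrite bigcup_seq => /bigcupP[z' z's tz'].
have z'Z : z' \in Z by move/allP: sZ; apply.
have zz' : z != z' by apply: contraNneq zs => ->.
by have /setP/(_ t) := G0 a z z' aA aC zZ z'Z zz'; rewrite !inE ta tz tz'.
Qed.

Lemma pblockP (P : {set {set T}}) x :
  pblock P x = set0 \/ pblock P x \in P /\ x \in pblock P x.
Proof.
have [xP|] := boolP (x \in cover P).
  by right; rewrite mem_pblock xP pblock_mem.
by move=> xP; left; rewrite /pblock; case: pickP => //= a /andP[aP xa];
  case/bigcupP: xP; exists a.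
Qed.

(* The A-set size governs the cost of a point: sizes 0 and 1 both make it free. *)
Definition deg x : nat := #|pblock A x|.

Lemma deg_gt0 x : 0 < deg x -> pblock A x \in A /\ x \in pblock A x.
Proof. by rewrite /deg; case: (pblockP A x) => [->|//]; rewrite cards0. Qed.

Lemma deg_mem a x : a \in A -> x \in a -> deg x = #|a|.
Proof. by move=> aA xa; rewrite /deg (def_pblock tA aA xa). Qed.

Lemma deg_le3 x : deg x <= 3.
Proof. by rewrite /deg; case: (pblockP A x) => [->|[/cardA]//]; rewrite cards0. Qed.

Lemma cost_le_sum C E : C \subset A ->
  cost C E <= \sum_(t in E | pblock A t \in C) phi (deg t).
Proof.
move=> sCA; rewrite costE.
apply: leq_trans (_ : \sum_(a in C) \sum_(t in E | pblock A t == a) phi #|a| <= _).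
  apply: leq_sum => a aC; case: ifP => // /set0Pn[x]; rewrite inE => /andP[xa xE].
  rewrite (bigD1 x) /= ?leq_addr // xE.
  by rewrite (def_pblock tA _ xa) ?eqxx ?(subsetP sCA).
rewrite (exchange_big_dep (mem E)) /=; last by move=> a t _ /andP[].
rewrite [leqRHS]big_mkcondr /=; apply: leq_sum => t tE.
case: ifP => tC.
  rewrite (bigD1 (pblock A t)) /=; last by rewrite tC tE eqxx.
  rewrite big1 ?addn0 // => a /andP[/andP[_ /andP[_ /eqP->]]].
  by rewrite eqxx.
by rewrite big1 // => a /andP[aC /andP[_ /eqP ta]]; rewrite ta aC in tC.
Qed.

(** Swapping in the pair of two such points would gain 10 and throw out only sets of weight 0. *)
Lemma free_unique b u u' : b \in B -> u \in b -> u' \in b ->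
  deg u <= 1 -> deg u' <= 1 -> u = u'.
Proof.
move=> bB ub u'b du du'; apply/eqP/negPn/negP => uu'.
have sb : [set u; u'] \subset b by rewrite subUset !sub1set ub.
have := @value_le_cost [set u; u'].
rewrite (value_single tB bB sb) cards2 uu' => /(_ _) le10.
have {}le10 := le10 (leq_trans (card_hit_single tB bB sb) (isT : 1 <= 10)).
move: le10.
rewrite leqNgt => /negP; apply; apply: leq_ltn_trans (cost_le_sum _ (subxx A)) _.
rewrite big1 // => t /andP[]; rewrite !inE => /orP[]/eqP-> _.
  by move: du; case: (deg u) => [|[]].
by move: du'; case: (deg u') => [|[]].
Qed.

(** * Critical points, their gadgets, and deficits *)

Definition full x := [forall u in pblock B x, 1 < deg u].
(** Off [cover B] the block is empty and [full] vacuous, so critical points lie in sets of [B]. *)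
Definition critical x := (1 < deg x) && ~~ full x.
Definition gadget w : {set T} :=
  if critical w then [set t in pblock B w | (t == w) || (deg t <= 1)] else set0.

Lemma critical_mem w : critical w ->
  [/\ pblock B w \in B, w \in pblock B w
    & exists2 u, u \in pblock B w & deg u <= 1].
Proof.
move=> /andP[_]; rewrite negb_forall => /existsP[u].
rewrite negb_imply -leqNgt => /andP[ub du].
case: (pblockP B w) => [b0|[bB wb]]; first by rewrite b0 inE in ub.
by split=> //; exists u.
Qed.

Lemma gadget_hit w : #|hit B (gadget w)| <= 1.
Proof.
rewrite /gadget; case: ifP => [/critical_mem[bB _ _]|_]; last by rewrite hit0 cards0.
by apply: (card_hit_single tB bB); apply/subsetP => t; rewrite inE => /andP[].
Qed.

Lemma gadget_deg w t : t \in gadget w -> t = w \/ deg t <= 1.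
Proof.
rewrite /gadget; case: ifP => _; last by rewrite inE.
by rewrite inE => /andP[_ /orP[/eqP|]]; auto.
Qed.

Lemma gadget_cost D w : D \subset B -> (critical w -> pblock B w \in D) ->
  cost (A :\ pblock A w) (gadget w) + 10 * critical w <= value D (gadget w).
Proof.
move=> sDB wD; have [cw|ncw] := boolP (critical w); last first.
  by rewrite /gadget (negPf ncw) cost0 value0.
have [bB wb [u ub du]] := critical_mem cw.
have sgb : gadget w \subset pblock B w.
  by rewrite /gadget cw; apply/subsetP => t; rewrite inE => /andP[].
have cost_g : cost (A :\ pblock A w) (gadget w) = 0.
  apply/eqP; rewrite -leqn0; apply: leq_trans (cost_le_sum _ (subD1set _ _)) _.
  rewrite big1 // => t /andP[/gadget_deg[->|dt _]]; first by rewrite !inE eqxx.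
  by move: dt; case: (deg t) => [|[]].
rewrite cost_g (value_single _ (wD cw) sgb); last exact: trivIsetS tB.
have sg : [set w; u] \subset gadget w.
  by rewrite subUset !sub1set /gadget cw !inE wb ub du eqxx orbT.
have wu : w != u.
  by apply: contraTneq du => <-; rewrite -ltnNge; case/andP: cw.
by have := phi_mono (subset_leq_card sg); rewrite cards2 wu.
Qed.

(* What is still to be paid for the A-set of [x] once the gadgets of all critical
   companions of [x] are swapped in; [slot x] is the corresponding point set. *)
Definition deficit x :=
  phi (deg x) - \sum_(z in pblock A x :\ x) 10 * critical z.
Definition slot x : {set T} :=
  x |: \bigcup_(z in pblock A x :\ x) gadget z.

Lemma gadget_pblock z z' a : a \in A -> z \in a -> z' \in a -> z != z' ->
  1 < #|a| -> a :&: (gadget z :&: gadget z') = set0.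
Proof.
move=> aA za z'a zz' a1; apply/eqP; rewrite -subset0; apply/subsetP => t.
rewrite !inE => /and3P[ta tz tz'].
have dt := deg_mem aA ta.
case: (gadget_deg tz) => [tz0|]; last by rewrite dt leqNgt a1.
case: (gadget_deg tz') => [tz'0|]; last by rewrite dt leqNgt a1.
by rewrite -tz0 -tz'0 eqxx in zz'.
Qed.

Lemma slot_hit b x : b \in B -> x \in b -> #|hit B (slot x)| <= 3.
Proof.
move=> bB xb; rewrite /slot hitU; apply: leq_trans (leq_card_setU _ _) _.
have hx : #|hit B [set x]| <= 1.
  by apply: (card_hit_single tB bB); rewrite sub1set.
have hz : forall z, z \in pblock A x :\ x -> #|hit B (gadget z)| <= 1.
  by move=> z _; apply: gadget_hit.
have := hit_bigcup hz; have := deg_le3 x; rewrite /deg.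
case: (pblockP A x) => [->|[_ xa]]; first by rewrite set0D cards0; lia.
by rewrite (cardsD1 x) xa; lia.
Qed.

(** As [b] has no free point, the gadgets of the companions lie in other sets of [B] and keep their
    value without [b]. They are glued with the common A-set left out, which is then added back once
    for [phi (deg x)]. *)
Lemma slot_cost b x : b \in B -> x \in b -> full x ->
  cost A (slot x) <= value (B :\ b) (slot x) + deficit x.
Proof.
move=> bB xb fx; have bx := def_pblock tB bB xb.
have dx : 1 < deg x by move/forall_inP: fx; apply; rewrite bx.
have [aA xa] := deg_gt0 (ltnW dx).
set a := pblock A x in aA xa.
set M := \bigcup_(z in a :\ x) gadget z.
have leM : cost (A :\ a) M + \sum_(z in a :\ x) 10 * critical z
    <= value (B :\ b) M + \sum_(z in a :\ x) 0.
  apply: merge_bigcup; rewrite ?subD1set //.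
  - by move=> z _; apply: leq_trans (gadget_hit z) _.
  - move=> a' z z' a'A; rewrite !inE a'A andbT negbK => /eqP->.
    by move=> /andP[_ za] /andP[_ z'a] zz'; apply: gadget_pblock.
  - move=> z; rewrite !inE addn0 => /andP[_ za].
    rewrite -(def_pblock tA aA za); apply: gadget_cost; rewrite ?subD1set //.
    move=> cz; have [zB zz _] := critical_mem cz; rewrite !inE zB andbT.
    apply: contraTneq cz => zb; rewrite negb_and; apply/orP; right.
    by rewrite negbK /full zb -bx.
rewrite [X in _ <= _ + X]big1 // addn0 in leM.
have cost_x : cost (A :\ a) [set x] = 0.
  apply/eqP; rewrite -leqn0; apply: leq_trans (cost_le_sum _ (subD1set _ _)) _.
  rewrite big1 // => t /andP[]; rewrite !inE => /eqP->.
  by rewrite -/a eqxx.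
have := cost_subadditive (A :\ a) [set x] M.
have := value_mono (B :\ b) (subsetUr [set x] M).
have /andP[_] := cost_setD1_bounds (slot x) aA.
rewrite /deficit -/a /slot -/M /deg -/a.
by move: leM cost_x; clear; lia.
Qed.

(** The glued slots break even without [b], up to the deficits; [b] then adds at least [phi #|Y|],
    which local optimality forces the deficits to absorb. *)
Lemma deficit_sum b (Y : {set T}) : b \in B -> Y \subset b ->
  (forall u, u \in b -> 1 < deg u) -> phi #|Y| <= \sum_(x in Y) deficit x.
Proof.
move=> bB sYb fb; set M := \bigcup_(x in Y) slot x.
have hx x : x \in Y -> #|hit B (slot x)| <= 3.
  by move=> /(subsetP sYb); apply: slot_hit.
have : cost A M + \sum_(x in Y) 0
    <= value (B :\ b) M + \sum_(x in Y) deficit x.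
  apply: merge_bigcup; rewrite ?subD1set //.
  - by move=> x xY; apply: leq_trans (hx x xY) _.
  - by move=> a z z' ->.
  - move=> x /(subsetP sYb) xb; rewrite addn0; apply: slot_cost => //.
    by apply/forall_inP => u; rewrite (def_pblock tB bB xb); apply: fb.
rewrite big1 // addn0 => leM.
have sYM : Y \subset b :&: M.
  rewrite subsetI sYb; apply/subsetP => x xY; apply/bigcupP; exists x => //.
  by rewrite !inE eqxx.
(* At most three slots, each meeting at most three sets of [B]. *)
have hM : #|hit B M| <= 10.
  apply: leq_trans (hit_bigcup hx) _.
  by have := subset_leq_card sYb; have := cardB bB; lia.
have := value_le_cost hM; rewrite (value_setD1 _ bB).
by have := phi_mono (subset_leq_card sYM); move: leM; lia.
Qed.

(** * Boosted points and the number of heavy points in a set of [A] *)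

Definition boosted z :=
  [&& full z, 10 < deficit z & [exists x in pblock B z, deficit x == 0]].

Definition heavy z := critical z || boosted z.

Lemma deficit_le x : deficit x <= phi (deg x).
Proof. exact: leq_subr. Qed.

(** Take [z] with the slot of a point [x] of deficit 0 in its B-set [b]: the slot pays for itself
    without [b], and [b] then adds 10 through [z] and [x]. *)
Lemma boosted_gadget z : boosted z ->
  exists E, [/\ #|hit B E| <= 3, E :&: pblock A z \subset [set z]
    & cost (A :\ pblock A z) E + 10 <= value B E].
Proof.
move=> /and3P[fz dz /exists_inP[x xb /eqP dx]].
case: (pblockP B z) => [b0|[bB zb]]; first by rewrite b0 inE in xb.
set b := pblock B z in xb bB zb.
have bx : pblock B x = b by apply: def_pblock.
have fb u : u \in b -> 1 < deg u by move/forall_inP: fz; apply.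
have degz : deg z = 3.
  move: (leq_trans dz (deficit_le z)) (deg_le3 z).
  by case: (deg z) => [|[|[|[|n]]]].
have [aA za] : pblock A z \in A /\ z \in pblock A z by apply: deg_gt0; rewrite degz.
have [aA' xa] : pblock A x \in A /\ x \in pblock A x.
  by apply/deg_gt0/ltnW/fb.
(* In a triple, two companions pay at most 20 of [phi 3 = 21], leaving a positive deficit. *)
have degx : deg x = 2.
  have : \sum_(w in pblock A x :\ x) 10 * critical w <= 10 * (deg x).-1.
    rewrite /deg (cardsD1 x) xa add1n /= mulnC -sum_nat_const; apply: leq_sum => w _.
    by case: critical.
  move/eqP: dx; rewrite subn_eq0 => le_phi /(leq_trans le_phi).
  by move: (deg_le3 x) (fb x xb); case: (deg x) => [|[|[|[|n]]]].
have slot_deg t : t \in slot x -> deg t <= 2.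
  rewrite !inE => /orP[/eqP->|/bigcupP[w]]; first by rewrite degx.
  rewrite !inE => /andP[_ wa] /gadget_deg[->|/leqW //].
  by rewrite (deg_mem aA' wa) -degx.
exists (z |: slot x); split.
- apply: leq_trans (slot_hit bB xb); apply: subset_leq_card.
  rewrite hitU subUset subxx andbT; apply/subsetP => c; rewrite !inE.
  move=> /andP[cB /set0Pn[t]]; rewrite !inE => /andP[tc /eqP tz].
  rewrite cB; apply/set0Pn; exists x; rewrite !inE eqxx andbT.
  by rewrite -(def_pblock tB cB tc) tz.
- apply/subsetP => t; rewrite in_setI in_setU1 in_set1 => /andP[+ ta].
  move=> /orP[//|/slot_deg].
  by rewrite (deg_mem aA ta) -/(deg z) degz.
have cost_z : cost (A :\ pblock A z) [set z] = 0.
  apply/eqP; rewrite -leqn0; apply: leq_trans (cost_le_sum _ (subD1set _ _)) _.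
  by rewrite big1 // => t /andP[]; rewrite !inE => /eqP->; rewrite eqxx.
have fx : full x by rewrite /full bx.
have := slot_cost bB xb fx; rewrite dx addn0.
have := cost_subadditive (A :\ pblock A z) [set z] (slot x).
have := value_mono (B :\ b) (subsetUr [set z] (slot x)).
have /andP[+ _] := cost_setD1_bounds (slot x) aA.
rewrite (value_setD1 _ bB).
have zx : z != x by apply: contraTneq dz => ->; rewrite dx.
have : [set z; x] \subset b :&: (z |: slot x).
  by rewrite subUset !sub1set !inE zb xb !eqxx orbT.
move=> /subset_leq_card/phi_mono; rewrite cards2 zx.
have phi2 : phi true.+1 = 10 by [].
rewrite phi2; move: cost_z; clear; lia.
Qed.

(** Glue one gadget per heavy point without paying for [a], then add [a] once. Thus a pair has at
    most one heavy point and a triple at most two. *)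
Lemma heavy_sum a : a \in A -> 1 < #|a| -> \sum_(z in a) 10 * heavy z <= phi #|a|.
Proof.
move=> aA a1.
have /fin_all_exists[G GP] z : exists E : {set T}, z \in a ->
    [/\ #|hit B E| <= 3, E :&: a \subset [set z]
      & cost (A :\ a) E + 10 * heavy z <= value B E].
  have [za|_] := boolP (z \in a); last by exists set0.
  have az := def_pblock tA aA za.
  rewrite /heavy; have [/boosted_gadget|_] := boolP (boosted z).
    by rewrite az orbT => -[E EP]; exists E.
  rewrite orbF; exists (gadget z) => _; split.
  - exact: leq_trans (gadget_hit z) _.
  - apply/subsetP => t; rewrite !inE => /andP[/gadget_deg[->//|dt] ta].
    by rewrite (deg_mem aA ta) leqNgt a1 in dt.
  - by rewrite -{1}az; apply: gadget_cost => // /critical_mem[].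
have hitG z : z \in a -> #|hit B (G z)| <= 3 by move=> /GP[].
set M := \bigcup_(z in a) G z.
have : cost (A :\ a) M + \sum_(z in a) 10 * heavy z <= value B M + \sum_(z in a) 0.
  apply: merge_bigcup; rewrite ?subD1set //.
  - by move=> z za; apply: leq_trans (hitG z za) _.
  - move=> a' z z' a'A; rewrite !inE a'A andbT negbK => /eqP-> za z'a zz'.
    have [_ /subsetP sz _] := GP z za; have [_ /subsetP sz' _] := GP z' z'a.
    apply/eqP; rewrite -subset0; apply/subsetP => t.
    rewrite !inE => /and3P[ta tz tz'].
    have := sz t; have := sz' t; rewrite !inE ta tz tz' => /(_ isT)/eqP tz0.
    by move=> /(_ isT)/eqP tz'0; rewrite -tz0 -tz'0 eqxx in zz'.
  - by move=> z za; rewrite addn0; have [] := GP z za.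
rewrite [X in _ <= _ + X]big1 // addn0.
have hM : #|hit B M| <= 10.
  by apply: leq_trans (hit_bigcup hitG) _; have := cardA aA; lia.
have := value_le_cost hM; have /andP[_] := cost_setD1_bounds M aA.
by clear; lia.
Qed.

(** * Discharging from [B] to [A] *)

Definition charge x :=
  if deg x <= 1 then 0 else
  if heavy x then 3 else if deficit x == 0 then 1 else 2.

(** A triple gets at most 2 per point plus 1 for each of at most two heavy points. In a pair no
    point is boosted; if one is critical, the other has deficit 0, giving 3 + 1, and otherwise 2 +
    2. *)
Lemma charge_received a : a \in A -> \sum_(x in a) charge x <= 4 * set_weight a.
Proof.
move=> aA; have [a1|a1] := leqP #|a| 1.
  by rewrite big1 // => x xa; rewrite /charge (deg_mem aA xa) a1.
have hs := heavy_sum aA a1; rewrite -big_distrr /= in hs.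
have [a3|an3] := eqVneq #|a| 3.
  have : \sum_(x in a) charge x <= \sum_(x in a) (2 + heavy x).
    by apply: leq_sum => x _; rewrite /charge; do ?case: ifP.
  rewrite big_split /= sum_nat_const; move: hs; rewrite a3 /set_weight a3.
  by rewrite /phi; lia.
have a2 : #|a| = 2 by have := cardA aA; lia.
have d10 x : x \in a -> deficit x <= 10.
  by move=> xa; apply: leq_trans (deficit_le x) _; rewrite (deg_mem aA xa) a2.
have nboost x : x \in a -> heavy x = critical x.
  by move=> /d10; rewrite /heavy /boosted leqNgt => /negPf->; rewrite andbF orbF.
have [x [y [xy axy]]] := cards2P a (introT eqP a2).
have [xa ya] : x \in a /\ y \in a by rewrite axy !inE !eqxx orbT.
have def_d x' y' : x' \in a -> a :\ x' = [set y'] ->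
    deficit x' = 10 - 10 * critical y'.
  move=> x'a ax'; rewrite /deficit (deg_mem aA x'a) a2.
  by rewrite (def_pblock tA aA x'a) ax' big_set1.
have dx := def_d x y xa; have dy := def_d y x ya.
have ax : a :\ x = [set y].
  by apply/setP => t; rewrite axy !inE; case: eqVneq => //= ->; rewrite (negPf xy).
have ay : a :\ y = [set x].
  apply/setP => t; rewrite axy !inE; case: eqVneq => //= [->|]; rewrite ?orbF //.
  by rewrite eq_sym (negPf xy).
move: hs; rewrite /set_weight a2.
rewrite (big_setD1 x) //= ax big_set1 (big_setD1 x) //= ax big_set1.
rewrite /charge !(deg_mem aA) // a2 !nboost // (dx ax) (dy ay).
by do 2!case: critical.
Qed.

(** Beside a free point all others are critical and send 3. Otherwise 2 per point suffices, unless
    some [x] has deficit 0. Then, in a triple, the other two deficits sum to at least 21, so one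
    exceeds 10 and its point is boosted: 1 + 2 + 3. *)
Lemma charge_sent b : b \in B -> 3 * set_weight b <= \sum_(x in b) charge x.
Proof.
move=> bB; rewrite /set_weight; have b3 := cardB bB.
have [/forall_inP fb|] := boolP [forall u in b, 1 < deg u]; last first.
  rewrite negb_forall => /existsP[u]; rewrite negb_imply -leqNgt => /andP[ub du].
  rewrite (big_setD1 u) //= (cardsD1 u b) ub add1n /= mulnC -sum_nat_const.
  apply: leq_trans (leq_addl _ _); apply: leq_sum => x.
  rewrite !inE => /andP[xu xb].
  have dx : 1 < deg x.
    by rewrite ltnNge; apply: contraNN xu => dx; rewrite (free_unique bB xb ub dx du).
  rewrite /charge [deg x <= 1]leqNgt dx /= /heavy /critical dx /=.
  rewrite (_ : full x = false) //; apply/negbTE.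
  rewrite negb_forall; apply/existsP; exists u.
  by rewrite (def_pblock tB bB xb) ub -leqNgt.
have charge_ge x : x \in b -> 1 + (deficit x != 0) <= charge x.
  move=> xb; rewrite /charge [deg _ <= 1]leqNgt fb //=; case: ifP => _; first by case: eqP.
  by case: eqP.
have [/exists_inP[x xb /eqP dx]|nbad] := boolP [exists x in b, deficit x == 0]; last first.
  apply: leq_trans (_ : #|b| * 2 <= _); first by lia.
  rewrite -sum_nat_const; apply: leq_sum => x xb.
  have := charge_ge x xb; case: eqP => // dx.
  by case/exists_inP: nbad; exists x => //; apply/eqP.
have other z : z \in b :\ x -> 10 <= deficit z.
  rewrite !inE => /andP[zx zb].
  have := @deficit_sum b [set x; z] bB; rewrite subUset !sub1set xb zb.
  move=> /(_ isT fb); rewrite cards2 eq_sym zx /= big_setU1 ?inE 1?eq_sym //=.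
  by rewrite big_set1 dx.
have charge_other z : z \in b :\ x -> 2 + (10 < deficit z) <= charge z.
  move=> zbx; have dz := other z zbx; move: zbx; rewrite !inE => /andP[zx zb].
  have [dz10|] := ltnP 10 (deficit z); last first.
    by move=> _; have := charge_ge z zb; case: eqP dz => [->|].
  have bz := def_pblock tB bB zb.
  have boost_z : boosted z.
    apply/and3P; split=> //; rewrite ?/full bz; first exact/forall_inP.
    by apply/exists_inP; exists x => //; apply/eqP.
  by rewrite /charge [deg _ <= 1]leqNgt fb //= /heavy boost_z orbT.
have := charge_ge x xb; have := deficit_sum bB (subxx b) fb.
rewrite !(big_setD1 x xb) /= dx add0n.
(* A deficit is at most [phi 3 = 21], hence the 11. *)
have : \sum_(z in b :\ x) deficit z <= \sum_(z in b :\ x) (10 + 11 * (10 < deficit z)).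
  apply: leq_sum => z _; have := deficit_le z; have := deg_le3 z.
  by rewrite /phi; lia.
have : \sum_(z in b :\ x) (2 + (10 < deficit z)) <= \sum_(z in b :\ x) charge z.
  by apply: leq_sum.
rewrite !big_split /= !sum_nat_const (cardsD1 x b) xb.
move: b3; rewrite (cardsD1 x b) xb /phi; lia.
Qed.

Lemma weight_bound : 3 * weight B <= 4 * weight A.
Proof.
rewrite /weight !big_distrr /=.
have sent : \sum_(b in B) 3 * set_weight b <= \sum_(b in B) \sum_(x in b) charge x.
  by apply: leq_sum => b; apply: charge_sent.
have recv : \sum_(a in A) \sum_(x in a) charge x <= \sum_(a in A) 4 * set_weight a.
  by apply: leq_sum => a; apply: charge_received.
apply: (leq_trans sent); apply: leq_trans recv.
(* Both double sums become sums over points; a point outside [cover A] has charge 0. *)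
rewrite -!big_trivIset //= big_mkcond [leqRHS]big_mkcond /=.
apply: leq_sum => x _; case: ifP => // _; case: ifP => // /negbT xA.
rewrite /charge; case: ifP => // /negbT; rewrite -ltnNge => /ltnW/deg_gt0[aA xa].
by case/bigcupP: xA; exists (pblock A x).
Qed.

End LocalOptimum.

Local Open Scope ring_scope.

Theorem theorem5 (T : finType) (S A B : {set {set T}}) :
  hereditary_3set_instance S ->
  feasible S A ->
  ~ (exists X : {set {set T}}, local_improvement S A X /\ (#|X| <= 10)%N) ->
  optimum S B ->
  (weight B)%:R <= 4%:R / 3%:R * (weight A)%:R :> rat.
Proof.
move=> instS feasA optA [feasB _].
have le34 := weight_bound instS feasA feasB optA.
rewrite GRing.mulrAC Num.Theory.ler_pdivlMr // -!GRing.natrM Num.Theory.ler_nat mulnC.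
exact: le34.
Qed.
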